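(* Let $\mathcal L$ be a differentiable real-valued function of a real matrix $W$ that is $L$-smooth and bounded below by $\mathcal L_{\inf}$. Let $W_0$ be an initial point and $\Delta_0:=\mathcal L(W_0)-\mathcal L_{\inf}$. Consider either of the two deterministic iterations (NormPre-G, or NormPre-L with exact eigenspace extraction) defined in the context, run under a fixed orientation $k$ for steps $t=0,\dots,T$ with constant step size $\eta$. For every $t$ and all row indices $i,j$, let $\phi_{t,i}$ be the angle between the gradient row $\bar g_{t,i}$ and the weight row $\bar w_{t,i}$, and let $\phi'_{t,j,i}$ be the angle between the normalized row $\psi_{t,j}$ and the weight row $\bar w_{t,i}$. Suppose there are constants $\gamma>0$ and $\gamma'$ such that $$\sin\phi_{t,i}\ge\gamma>0\quad\text{and}\quad\Big(\sum_{j}\cos^2\phi'_{t,j,i}\Big)^{1/2}\le\gamma'\qquad\text{for all }t,i .$$ Define $$\nu_t:=\max_i\frac{\|\bar g_{t,i}-x_{t,i}\|_2}{\|x_{t,i}\|_2},\qquad \chi_t:=\begin{cases}\widetilde\sigma_{t,1}/\widetilde\sigma_{t,m}&\text{for NormPre-G (assuming }\Gamma_t\succ0\text{ for all }t),\\ \widetilde\sigma_{t,1}&\text{for NormPre-L (exact)}.\end{cases}$$ Assume there exists $\epsilon>0$ such that $\max_{0\le t\le T}\nu_t\gamma'\chi_t\le1-\epsilon$. Then for any constant $C>0$, choosing $\eta=C/\sqrt{T+1}$ yields $$\min_{0\le t\le T}\|\nabla\mathcal L(W_t)\|_F\le\frac{1}{\sqrt{T+1}}\left(\frac{\Delta_0\max\{m,n\}^{1/2}}{\epsilon\gamma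 C}+\frac{LC\max\{m,n\}^{3/2}}{2\epsilon\gamma}\right).$$
   Context: Orientation. Fix $k\in\{0,1\}$ and let $\mathcal O_0(A)=A$, $\mathcal O_1(A)=A^\top$. The parameters $W_t$ are real matrices such that the oriented matrix $\overline W_t:=\mathcal O_k(W_t)$ lies in $\mathbb R^{m\times n}$. $L$-smooth means that $\nabla\mathcal L$ is $L$-Lipschitz with respect to the Frobenius norm. One step (no stochasticity, momentum, RMS scaling or weight decay). Let $G_t:=\nabla\mathcal L(W_t)$ and $\overline G_t:=\mathcal O_k(G_t)\in\mathbb R^{m\times n}$. Let $\bar w_{t,i}$, $\bar g_{t,i}$ be the $i$-th rows of $\overline W_t$, $\overline G_t$. The relaxed tangent gradient $X_t\in\mathbb R^{m\times n}$ has rows $$x_{t,i}:=\bar g_{t,i}-\langle\bar g_{t,i},\bar w_{t,i}\rangle\,\bar w_{t,i}$$ (with no division by $\|\bar w_{t,i}\|_2^2$). Let $D(X_t):=\operatorname{Diag}(\|x_{t,1}\|_2,\dots,\|x_{t,m}\|_2)$ and $\Psi_t:=D(X_t)^{-1}X_t$, whose rows are $\psi_{t,i}=x_{t,i}/\|x_{t,i}\|_2$. It is assumed throughout that all $x_{t,i}\neq0$ (the normalization is well defined) and that all $\bar g_{t,i},\bar w_{t,i}$ are nonzero (so the angles are defined). Let $\Gamma_t:=\Psi_t\Psi_t^\top\in\mathbb R^{m\times m}$, with eigendecomposition $\Gamma_t=\widetilde U_t\Lambda_t\widetilde U_t^\top$, $\Lambda_t=\operatorname{Diag}(\lambda_{t,1},\dots,\lambda_{t,m})$,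 $\lambda_{t,1}\ge\dots\ge\lambda_{t,m}\ge0$, and put $\widetilde\sigma_{t,i}:=\sqrt{\lambda_{t,i}}$ (the singular values of $\Psi_t$). The spectral preconditioner $P_t$ is: - NormPre-G: $P_t:=\Gamma_t^{-1/2}$ (with $\Gamma_t\succ0$), so $T_t:=P_t\Psi_t$ is the exact matrix sign (polar factor) of $\Psi_t$. - NormPre-L (exact), with a given rank budget $r\geq 1$: let $\mathcal A_t:=\{i:\lambda_{t,i}>1\}$ and let $\mathcal C_t\subseteq\mathcal A_t$ index the $\min\{r,|\mathcal A_t|\}$ largest eigenvalues among those in $\mathcal A_t$ (ties broken arbitrarily). Then $P_t:=I_m+\widetilde U_{\mathcal C_t}(\Lambda_{\mathcal C_t}^{-1/2}-I)\widetilde U_{\mathcal C_t}^\top$, where $\widetilde U_{\mathcal C_t}$ consists of the columns of $\widetilde U_t$ indexed by $\mathcal C_t$ and $\Lambda_{\mathcal C_t}:=\operatorname{Diag}(\lambda_{t,i})_{i\in\mathcal C_t}$; and $T_t:=P_t\Psi_t$. The update is $W_{t+1}=W_t-\eta\,\mathcal O_k^{-1}(T_t)$. *)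

(* Defs.v *)
From HB Require Import structures.
From mathcomp Require Import all_boot all_order all_algebra.
From mathcomp Require Import all_classical all_reals all_analysis.
Set Implicit Arguments.
Unset Strict Implicit.
Unset Printing Implicit Defensive.
Import Order.TTheory GRing.Theory Num.Theory numFieldNormedType.Exports.
Local Open Scope ring_scope.

(* Seeding with the value at ord0 makes these the exact maximum and minimum of
   a nonempty finite family, without assuming a sign. *)
Definition maxord (R : realType) (n : nat) (F : 'I_n.+1 -> R) : R :=
  \big[Num.max/F ord0]_(i < n.+1) F i.

Definition minord (R : realType) (n : nat) (F : 'I_n.+1 -> R) : R :=
  \big[Num.min/F ord0]_(i < n.+1) F i.

(* Frobenius inner product and norm.  The library norm on matrices is the
   max-entry norm.  On row vectors these are the Euclidean ones. *)
Definition mxdot (R : realType) (a b : nat) (A B : 'M[R]_(a, b)) : R :=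
  \tr (A *m B^T).

Definition fnorm (R : realType) (a b : nat) (A : 'M[R]_(a, b)) : R :=
  Num.sqrt (mxdot A A).

(* Meaningful only for nonzero u and v. *)
Definition angle (R : realType) (n : nat) (u v : 'rV[R]_n) : R :=
  acos (mxdot u v / (fnorm u * fnorm v)).

(* The matrix of partial derivatives; where f is differentiable it represents
   the differential for mxdot. *)
Definition grad (R : realType) (a b : nat) (f : 'M[R]_(a, b) -> R)
    (W : 'M[R]_(a, b)) : 'M[R]_(a, b) :=
  \matrix_(i, j) 'D_(delta_mx i j) f W.

Definition lsmooth (R : realType) (a b : nat) (f : 'M[R]_(a, b) -> R) (L : R)
    : Prop :=
  forall A B : 'M[R]_(a, b), fnorm (grad f A - grad f B) <= L * fnorm (A - B).

(* Orientation k: false is the identity, true is transposition.  Parameters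
   have shape (wrows k m n, wcols k m n), so that oriented ones are m x n. *)
Definition wrows (k : bool) (m n : nat) : nat := if k then n else m.
Definition wcols (k : bool) (m n : nat) : nat := if k then m else n.

Definition orient (R : realType) (k : bool) (m n : nat) :
    'M[R]_(wrows k m n, wcols k m n) -> 'M[R]_(m, n) :=
  match k with false => fun A => A | true => fun A => A^T end.

Definition deorient (R : realType) (k : bool) (m n : nat) :
    'M[R]_(m, n) -> 'M[R]_(wrows k m n, wcols k m n) :=
  match k with false => fun A => A | true => fun A => A^T end.

(* No division by the squared norm of the row of W. *)
Definition relaxed_tangent (R : realType) (m n : nat) (G W : 'M[R]_(m, n))
    : 'M[R]_(m, n) :=
  \matrix_(i < m) (row i G - mxdot (row i G) (row i W) *: row i W).

Definition row_normalize (R : realType) (m n : nat) (X : 'M[R]_(m, n))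
    : 'M[R]_(m, n) :=
  \matrix_(i < m) ((fnorm (row i X))^-1 *: row i X).

Definition posdef (R : realType) (m : nat) (A : 'M[R]_m) : Prop :=
  A^T = A /\ forall v : 'rV[R]_m, v != 0 -> 0 < mxdot (v *m A) v.

Definition sorted_eigendecomp (R : realType) (m : nat) (A U : 'M[R]_m)
    (lam : 'rV[R]_m) : Prop :=
  [/\ U^T *m U = 1%:M,
      A = U *m diag_mx lam *m U^T,
      forall i j : 'I_m, (i <= j)%N -> lam 0 j <= lam 0 i &
      forall i : 'I_m, 0 <= lam 0 i].

(* P = A ^ (-1/2): the positive definite square root of the inverse of A. *)
Definition is_inv_sqrt (R : realType) (m : nat) (A P : 'M[R]_m) : Prop :=
  [/\ A \in unitmx, posdef P & P *m P = invmx A].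

Definition active_set (R : realType) (m : nat) (lam : 'rV[R]_m) : {set 'I_m} :=
  [set i | 1 < lam 0 i].

(* C indexes min(r, #|active_set lam|) largest active eigenvalues; any way of
   breaking ties is allowed. *)
Definition top_active (R : realType) (m r : nat) (lam : 'rV[R]_m)
    (C : {set 'I_m}) : Prop :=
  [/\ C \subset active_set lam,
      #|C| = minn r #|active_set lam| &
      forall i j : 'I_m, i \in C -> j \in active_set lam :\: C ->
        lam 0 j <= lam 0 i].

Definition clip_precond (R : realType) (m : nat) (U : 'M[R]_m)
    (lam : 'rV[R]_m) (C : {set 'I_m}) : 'M[R]_m :=
  let UC : 'M[R]_(m, #|C|) := colsub (fun c : 'I_#|C| => enum_val c) U in
  let LC := diag_mx (\row_(c < #|C|) (Num.sqrt (lam 0 (enum_val c)))^-1) in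
  1%:M + UC *m (LC - 1%:M) *m UC^T.

(* NormPreL carries its rank budget. *)
Inductive normpre := NormPreG | NormPreL of nat.

Definition valid_normpre (M : normpre) : Prop :=
  match M with NormPreG => True | NormPreL r => (1 <= r)%N end.

Definition is_precond (R : realType) (M : normpre) (m : nat)
    (Gamma U : 'M[R]_m) (lam : 'rV[R]_m) (P : 'M[R]_m) : Prop :=
  match M with
  | NormPreG => posdef Gamma /\ is_inv_sqrt Gamma P
  | NormPreL r => exists2 C : {set 'I_m},
      top_active r lam C & P = clip_precond U lam C
  end.

Definition nu (R : realType) (m n : nat) (G X : 'M[R]_(m.+1, n)) : R :=
  maxord (fun i => fnorm (row i G - row i X) / fnorm (row i X)).

Definition chi (R : realType) (M : normpre) (m : nat) (lam : 'rV[R]_m.+1) : R :=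
  match M with
  | NormPreG => Num.sqrt (lam 0 ord0) / Num.sqrt (lam 0 ord_max)
  | NormPreL _ => Num.sqrt (lam 0 ord0)
  end.

(* Main.v *)
(* In the eigenbasis of Gamma both preconditioners are P = U diag(p) U^T with
   1/sigma_1 <= p_k <= q, where chi = q sigma_1.  The rows of Psi are unit
   vectors, so Gamma has unit diagonal and (Gamma P)_ii >= Gamma_ii / sigma_1 =
   1/sigma_1; hence <x_i, t_i> >= |x_i| / sigma_1 for the rows t_i of P Psi.
   The remaining part g_i - x_i is parallel to w_i, and
   |<w_i, t_i>| <= q gamma' |w_i| by Cauchy-Schwarz, so that
   <g_i, t_i> >= |x_i| (1 - nu gamma' chi) / sigma_1
              >= eps gamma |g_i| / sqrt m.
   Since also |P Psi|_F^2 <= m, the descent lemma for L-smooth functions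
   telescopes to the stated bound. *)

Require Import Defs.
From HB Require Import structures.
From mathcomp Require Import all_boot all_order all_algebra.
From mathcomp Require Import all_classical all_reals all_analysis.
From mathcomp Require Import ring lra.
Set Implicit Arguments.
Unset Strict Implicit.
Unset Printing Implicit Defensive.
Import Order.TTheory GRing.Theory Num.Theory numFieldNormedType.Exports.
Local Open Scope ring_scope.

(** * Frobenius inner product and Cauchy-Schwarz *)

Section Frobenius.
Variable R : realType.

Lemma mxdotE a b (A B : 'M[R]_(a, b)) :
  mxdot A B = \sum_i \sum_j A i j * B i j.
Proof.
by apply: eq_bigr => i _; rewrite mxE; apply: eq_bigr => j _; rewrite mxE.
Qed.

Lemma mxdotC a b (A B : 'M[R]_(a, b)) : mxdot A B = mxdot B A.
Proof.
by rewrite !mxdotE; do 2!apply: eq_bigr => ? _; rewrite mulrC.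
Qed.

Lemma mxdotDl a b (A B C : 'M[R]_(a, b)) :
  mxdot (A + B) C = mxdot A C + mxdot B C.
Proof. by rewrite /mxdot mulmxDl linearD. Qed.

Lemma mxdotZl a b c (A B : 'M[R]_(a, b)) : mxdot (c *: A) B = c * mxdot A B.
Proof. by rewrite /mxdot -scalemxAl linearZ. Qed.

Lemma mxdotNl a b (A B : 'M[R]_(a, b)) : mxdot (- A) B = - mxdot A B.
Proof. by rewrite -scaleN1r mxdotZl mulN1r. Qed.

Lemma mxdotZr a b c (A B : 'M[R]_(a, b)) : mxdot A (c *: B) = c * mxdot A B.
Proof. by rewrite mxdotC mxdotZl mxdotC. Qed.

Lemma mxdotDr a b (A B C : 'M[R]_(a, b)) :
  mxdot A (B + C) = mxdot A B + mxdot A C.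
Proof. by rewrite mxdotC mxdotDl !(mxdotC A). Qed.

Lemma mxdotNr a b (A B : 'M[R]_(a, b)) : mxdot A (- B) = - mxdot A B.
Proof. by rewrite mxdotC mxdotNl mxdotC. Qed.

Lemma mxdot_tr a b (A B : 'M[R]_(a, b)) : mxdot A^T B^T = mxdot A B.
Proof. by rewrite /mxdot trmxK mxtrace_mulC -mxtrace_tr trmx_mul trmxK. Qed.

Lemma mxdot_row a b (A B : 'M[R]_(a, b)) :
  mxdot A B = \sum_i mxdot (row i A) (row i B).
Proof.
rewrite mxdotE; apply: eq_bigr => i _.
by rewrite mxdotE big_ord1; apply: eq_bigr => j _; rewrite !mxE.
Qed.

Lemma mxdot_rows a b c (A : 'M[R]_(a, c)) (B : 'M[R]_(b, c)) i j :
  mxdot (row i A) (row j B) = (A *m B^T) i j.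
Proof.
by rewrite mxdotE big_ord1 !mxE; apply: eq_bigr => l _; rewrite !mxE.
Qed.

Lemma mxdot_mulmx_row a b c (A : 'M[R]_(a, b)) (B : 'M[R]_(b, c)) i v :
  mxdot (row i (A *m B)) v = \sum_j A i j * mxdot (row j B) v.
Proof.
rewrite mxdotE big_ord1.
under [RHS]eq_bigr => j _ do rewrite mxdotE big_ord1 mulr_sumr.
rewrite exchange_big; apply: eq_bigr => l _.
rewrite !mxE mulr_suml; apply: eq_bigr => j _.
by rewrite !mxE mulrA.
Qed.

Lemma mxdot_ge0 a b (A : 'M[R]_(a, b)) : 0 <= mxdot A A.
Proof.
by rewrite mxdotE; do 2!apply: sumr_ge0 => ? _; rewrite -expr2 sqr_ge0.
Qed.

Lemma mxdot_eq0 a b (A : 'M[R]_(a, b)) : (mxdot A A == 0) = (A == 0).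
Proof.
apply/eqP/eqP => [|->]; last by rewrite /mxdot mul0mx linear0.
have sq_ge0 i j : 0 <= A i j * A i j by rewrite -expr2 sqr_ge0.
rewrite mxdotE => /eqP; rewrite psumr_eq0; last first.
  by move=> i _; apply: sumr_ge0.
move=> /allP A0; apply/matrixP => i j; rewrite mxE.
have := A0 i (mem_index_enum _); rewrite psumr_eq0 //.
move=> /allP /(_ j (mem_index_enum _)).
by rewrite mulf_eq0 orbb => /eqP.
Qed.

Lemma fnorm_ge0 a b (A : 'M[R]_(a, b)) : 0 <= fnorm A.
Proof. exact: sqrtr_ge0. Qed.

Lemma fnorm_sqr a b (A : 'M[R]_(a, b)) : fnorm A ^+ 2 = mxdot A A.
Proof. by rewrite sqr_sqrtr // mxdot_ge0. Qed.

Lemma fnorm_gt0 a b (A : 'M[R]_(a, b)) : (0 < fnorm A) = (A != 0).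
Proof. by rewrite sqrtr_gt0 lt_def mxdot_ge0 mxdot_eq0 andbT. Qed.

Lemma fnormZ a b c (A : 'M[R]_(a, b)) : fnorm (c *: A) = `|c| * fnorm A.
Proof.
by rewrite /fnorm mxdotZl mxdotZr mulrA -expr2 sqrtrM ?sqr_ge0// sqrtr_sqr.
Qed.

(** Expand the nonnegative square of [<B,B> A - <A,B> B]: it equals [<B,B>] times the difference of
    the two sides. *)
Lemma mxdot_sqr_le a b (A B : 'M[R]_(a, b)) :
  mxdot A B ^+ 2 <= mxdot A A * mxdot B B.
Proof.
have [->|B0] := eqVneq B 0.
  by rewrite /mxdot trmx0 !mulmx0 !linear0 expr0n mulr0.
have BB : 0 < mxdot B B by rewrite lt_def mxdot_eq0 B0 mxdot_ge0.
have := mxdot_ge0 (mxdot B B *: A - mxdot A B *: B).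
rewrite mxdotDl !mxdotDr !mxdotNl !mxdotNr !mxdotZl !mxdotZr (mxdotC B A) => h.
rewrite -subr_ge0 -(pmulr_rge0 _ BB); apply: le_trans h _.
by rewrite le_eqVlt; apply/orP; left; apply/eqP; ring.
Qed.

Lemma mxdot_le a b (A B : 'M[R]_(a, b)) : `|mxdot A B| <= fnorm A * fnorm B.
Proof.
rewrite -ler_sqr ?nnegrE ?mulr_ge0 ?fnorm_ge0//.
by rewrite real_normK ?num_real// exprMn !fnorm_sqr mxdot_sqr_le.
Qed.

Lemma sum_mul_le m (x y : 'I_m -> R) :
  `|\sum_i x i * y i| <= Num.sqrt (\sum_i x i ^+ 2) * Num.sqrt (\sum_i y i ^+ 2).
Proof.
have := mxdot_le (\row_i x i) (\row_i y i).
rewrite /fnorm !mxdotE !big_ord1.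
have E (u v : 'I_m -> R) :
    \sum_j (\row_i u i) 0 j * (\row_i v i) 0 j = \sum_j u j * v j.
  by apply: eq_bigr => j _; rewrite !mxE.
by rewrite !E; congr (_ <= Num.sqrt _ * Num.sqrt _); apply: eq_bigr => j _;
  rewrite expr2.
Qed.

End Frobenius.

(** * Gradients and the descent lemma *)

Section Descent.
Variables (R : realType) (a b : nat) (f : 'M[R]_(a, b) -> R) (L : R).
Hypothesis f_diff : forall V, differentiable f V.
Hypothesis f_smooth : lsmooth f L.

(** Differentiability makes the directional derivative linear in [Z]; expanding [Z] in the basis of
    the [delta_mx i j] leaves only partial derivatives. *)
Lemma derive_grad V Z : 'D_Z f V = mxdot (grad f V) Z.
Proof.
rewrite deriveE// {1}(matrix_sum_delta Z) linear_sum mxdotE.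
apply: eq_bigr => i _; rewrite linear_sum; apply: eq_bigr => j _.
by rewrite linearZ/= mxE deriveE// mulrC.
Qed.

(** The difference quotient of the restriction at [s] is literally that of [f] at [A + s *: V] in
    direction [V]. *)
Lemma is_derive_line A V (s : R) :
  is_derive s (1 : R) (fun s => f (A + s *: V)) (mxdot (grad f (A + s *: V)) V).
Proof.
have E : (fun h : R => h^-1 *: (((fun s => f (A + s *: V)) \o shift s) (h *: 1)
            - f (A + s *: V))) =
         (fun h : R => h^-1 *: ((f \o shift (A + s *: V)) (h *: V)
            - f (A + s *: V))).
  apply/funext => h /=; congr (_ *: (f _ - _)).
  by rewrite scalerDl addrCA /GRing.scale/= mulr1.
apply: DeriveDef.
  by rewrite /derivable E; exact: diff_derivable.
by rewrite /derive E -derive_grad.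
Qed.

Lemma descent A V :
  f (A + V) <= f A + mxdot (grad f A) V + L / 2 * mxdot V V.
Proof.
(* Subtracting the linear and quadratic terms turns the claim into [g 1 <= g 0]. By the mean value
   theorem it suffices that [g] has nonpositive slope at the intermediate point [c]; there the
   gradient has moved by at most [L * c * fnorm V]. *)
pose g s :=
  f (A + s *: V) - s * mxdot (grad f A) V - s ^+ 2 * (L / 2 * mxdot V V).
have dg (s : R) : is_derive s (1 : R) g
    (mxdot (grad f (A + s *: V)) V - mxdot (grad f A) V - s * (L * mxdot V V)).
  have df := is_derive_line A V s.
  rewrite /g; apply: is_derive_eq.
  rewrite /GRing.scale/=; lra.
have [c c01] := @MVT_segment R g _ 0 1 ler01 (fun s _ => dg s)
  (derivable_within_continuous (fun s _ => @ex_derive _ _ _ _ _ _ _ (dg s))).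
rewrite /g scale0r addr0 scale1r subr0 mulr1 => E.
have c0 : 0 <= c by move: c01; rewrite in_itv/= => /andP[].
suff : mxdot (grad f (A + c *: V)) V - mxdot (grad f A) V <= c * (L * mxdot V V).
  by move: E; set u := f _; set v := f _; nra.
rewrite -mxdotNl -mxdotDl; apply: le_trans (ler_norm _) _.
apply: le_trans (mxdot_le _ _) _.
have := f_smooth (A + c *: V) A.
rewrite addrAC subrr add0r fnormZ ger0_norm// => h.
apply: le_trans (ler_wpM2r (fnorm_ge0 _) h) _.
by rewrite -fnorm_sqr expr2; rewrite le_eqVlt; apply/orP; left; apply/eqP; ring.
Qed.

End Descent.

(** Compare the gradients at the all-ones matrix and at 0. Both dimensions are successors so that
    these two points are distinct. *)
Lemma lsmooth_ge0 (R : realType) a b (f : 'M[R]_(a.+1, b.+1) -> R) L :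
  lsmooth f L -> 0 <= L.
Proof.
move=> /(_ (const_mx 1) 0); rewrite subr0 => h.
have N0 : 0 < fnorm (const_mx 1 : 'M[R]_(a.+1, b.+1)).
  rewrite fnorm_gt0; apply/eqP => /matrixP /(_ ord0 ord0) /eqP.
  by rewrite !mxE oner_eq0.
by rewrite -(pmulr_lge0 _ N0) (le_trans _ h) // fnorm_ge0.
Qed.

(** * Angles between rows *)

Section Angles.
Variables (R : realType) (n : nat).
Implicit Types u v g w : 'rV[R]_n.

Lemma cosine_itv u v : u != 0 -> v != 0 ->
  -1 <= mxdot u v / (fnorm u * fnorm v) <= 1.
Proof.
rewrite -!fnorm_gt0 => u0 v0; rewrite -ler_norml normrM.
have uv : 0 < fnorm u * fnorm v by rewrite mulr_gt0.
by rewrite normfV (gtr0_norm uv) ler_pdivrMr// mul1r mxdot_le.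
Qed.

Lemma mxdot_cos_angle u v : u != 0 -> v != 0 ->
  mxdot u v = fnorm u * fnorm v * cos (angle u v).
Proof.
move=> u0 v0; rewrite /angle acosK; last by rewrite in_itv/= cosine_itv.
by rewrite mulrC divfK// mulf_neq0// gt_eqF// fnorm_gt0.
Qed.

(* [|x|^2 - (|g| sin)^2 = <g, w>^2 (|w| - 1 / |w|)^2] *)
Lemma fnorm_sin_angle_le g w : g != 0 -> w != 0 ->
  fnorm g * sin (angle g w) <= fnorm (g - mxdot g w *: w).
Proof.
move=> g0 w0; have /andP[c1 c2] := cosine_itv g0 w0.
rewrite /angle sin_acos ?c1//.
move: g0 w0; rewrite -!fnorm_gt0 => g0 w0.
rewrite -{1}(ger0_norm (fnorm_ge0 g)) -sqrtr_sqr -sqrtrM ?sqr_ge0//.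
rewrite ler_wsqrtr// mxdotDl !mxdotDr !mxdotNl !mxdotNr !mxdotZl !mxdotZr.
rewrite (mxdotC w g) -!fnorm_sqr -subr_ge0.
set s := (X in 0 <= X).
suff -> : s = (mxdot g w * (fnorm w - (fnorm w)^-1)) ^+ 2 by rewrite sqr_ge0.
by rewrite /s; field; rewrite !gt_eqF.
Qed.

End Angles.

(** * Matrices diagonal in an orthonormal basis, positive definite roots *)

Section Spectral.
Variables (R : realType) (m : nat).
Implicit Types (A P Q U : 'M[R]_m) (d e lam : 'rV[R]_m).

Lemma orth_diag_entry U d i j :
  (U *m diag_mx d *m U^T) i j = \sum_k d 0 k * (U i k * U j k).
Proof.
rewrite mul_mx_diag mxE; apply: eq_bigr => k _.
by rewrite !mxE mulrAC mulrC mulrA.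
Qed.

Lemma orth_diag_tr U d : (U *m diag_mx d *m U^T)^T = U *m diag_mx d *m U^T.
Proof. by rewrite !trmx_mul trmxK tr_diag_mx mulmxA. Qed.

Lemma orth_diag_mul U d e : U^T *m U = 1%:M ->
  U *m diag_mx d *m U^T *m (U *m diag_mx e *m U^T) =
  U *m diag_mx (\row_k (d 0 k * e 0 k)) *m U^T.
Proof.
move=> UU; rewrite !mulmxA -(mulmxA (U *m diag_mx d)) UU mulmx1.
by rewrite -(mulmxA U (diag_mx d)) mulmx_diag.
Qed.

Lemma orth_diag_trace U d : U^T *m U = 1%:M ->
  \tr (U *m diag_mx d *m U^T) = \sum_k d 0 k.
Proof.
by move=> UU; rewrite mxtrace_mulC mulmxA UU mul1mx mxtrace_diag.
Qed.

Lemma orth_row_sqr_sum U i : U^T *m U = 1%:M -> \sum_k U i k ^+ 2 = 1.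
Proof.
(* The hypothesis is orthonormality of the columns; for a square matrix it passes to the rows. *)
move=> /mulmx1C /matrixP /(_ i i); rewrite !mxE eqxx mulr1n => <-.
by apply: eq_bigr => k _; rewrite !mxE expr2.
Qed.

Lemma posdef_form_ge0 k A (Z : 'M[R]_(k, m)) :
  posdef A -> 0 <= mxdot (Z *m A) Z.
Proof.
move=> [_ Apos]; rewrite mxdot_row; apply: sumr_ge0 => i _; rewrite row_mul.
have [->|/Apos/ltW//] := eqVneq (row i Z) 0.
by rewrite mul0mx /mxdot mul0mx linear0.
Qed.

(** The form is a sum of nonnegative contributions of the rows of [Z], so each of them vanishes. *)
Lemma posdef_form_eq0 k A (Z : 'M[R]_(k, m)) :
  posdef A -> mxdot (Z *m A) Z = 0 -> Z = 0.
Proof.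
move=> Apos Z0; apply/row_matrixP => i; rewrite row0.
apply/eqP/negP => /negP Zi.
have := Apos.2 _ Zi; rewrite -row_mul.
suff -> : mxdot (row i (Z *m A)) (row i Z) = 0 by rewrite ltxx.
apply/eqP; move: Z0 => /eqP; rewrite mxdot_row psumr_eq0.
  by move=> /allP /(_ i (mem_index_enum _)).
by move=> j _; rewrite row_mul posdef_form_ge0.
Qed.

(* With [Z = P - Q], [P^2 = Q^2] gives [P Z + Z Q = 0]; pairing with [Z] leaves
   a sum of two nonnegative forms. *)
Lemma posdef_sqrt_uniq P Q : posdef P -> posdef Q -> P *m P = Q *m Q -> P = Q.
Proof.
move=> Ppos Qpos PQ; pose Z := P - Q.
have : mxdot (P *m Z + Z *m Q) Z = 0.
  rewrite /Z mulmxBr mulmxBl PQ addrA subrK subrr.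
  by rewrite /mxdot mul0mx linear0.
rewrite mxdotDl -mxdot_tr trmx_mul Ppos.1 => S0.
have P0 := posdef_form_ge0 Z^T Ppos; have Q0 := posdef_form_ge0 Z Qpos.
have /(posdef_form_eq0 Qpos) : mxdot (Z *m Q) Z = 0 by lra.
by move=> /eqP; rewrite subr_eq0 => /eqP.
Qed.

Lemma posdef_orth_diag U d c : U^T *m U = 1%:M -> 0 < c ->
  (forall k, c <= d 0 k) -> posdef (U *m diag_mx d *m U^T).
Proof.
move=> UU c0 cd; split=> [|v v0]; first exact: orth_diag_tr.
have vU : mxdot (v *m U) (v *m U) = mxdot v v.
  by rewrite /mxdot trmx_mul !mulmxA -(mulmxA v) (mulmx1C UU) mulmx1.
have -> : mxdot (v *m (U *m diag_mx d *m U^T)) v =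
          mxdot (v *m U *m diag_mx d) (v *m U).
  by rewrite /mxdot trmx_mul !mulmxA.
have vv : 0 < mxdot v v by rewrite lt_def mxdot_eq0 v0 mxdot_ge0.
apply: lt_le_trans (mulr_gt0 c0 vv) _; rewrite -vU !mxdotE !big_ord1 mulr_sumr.
apply: ler_sum => k _; rewrite mul_mx_diag !mxE.
by rewrite [leRHS]mulrAC [leRHS]mulrC ler_wpM2r// -expr2 sqr_ge0.
Qed.

(** Evaluated on column [k] of [U], a unit vector, the quadratic form of [A] is [lam 0 k]. *)
Lemma posdef_eigen_gt0 A U lam k : sorted_eigendecomp A U lam -> posdef A ->
  0 < lam 0 k.
Proof.
move=> [UU AE _ _] [_ Apos].
have := mxdot_rows U^T U^T k k; rewrite trmxK UU mxE eqxx mulr1n => Uk.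
have /Apos : row k U^T != 0.
  by rewrite -mxdot_eq0 Uk oner_eq0.
rewrite -row_mul mxdot_rows trmxK AE !mulmxA UU mul1mx -mulmxA UU mulmx1.
by rewrite mxE eqxx mulr1n.
Qed.

(** Writing the identity as [U *m U^T], clipping changes the factor of an eigenvector in [C] from 1
    to [1 + (1 / sigma_k - 1)] and leaves the others at 1. *)
Lemma clip_precondE U lam (C : {set 'I_m}) : U^T *m U = 1%:M ->
  clip_precond U lam C =
  U *m diag_mx (\row_k if k \in C then (Num.sqrt (lam 0 k))^-1 else 1) *m U^T.
Proof.
move=> UU; apply/matrixP => i j; rewrite orth_diag_entry /clip_precond.
rewrite -(mulmx1C UU) -diag_const_mx -linearB/= mul_mx_diag !mxE.
under [X in _ + X]eq_bigr => c _ do rewrite !mxE.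
rewrite -(big_enum_val (A := mem C) (fun k =>
  U i k * ((Num.sqrt (lam 0 k))^-1 - 1) * U j k))
  [X in _ + X]big_mkcond -big_split/=.
apply: eq_bigr => k _; rewrite !mxE; case: ifP => _; ring.
Qed.

End Spectral.

(** * Spectral bounds common to both preconditioners *)

Section Preconditioner.
Variables (R : realType) (M : normpre) (m : nat).
Variables (Gamma U P : 'M[R]_m.+1) (lam : 'rV[R]_m.+1).
Hypothesis eig : sorted_eigendecomp Gamma U lam.
Hypothesis diag1 : forall i, Gamma i i = 1.

Lemma unit_diag_eigen_sum : \sum_k lam 0 k = m.+1%:R.
Proof.
case: eig => UU GE _ _; rewrite -(orth_diag_trace lam UU) -GE.
rewrite /mxtrace (eq_bigr (fun=> 1)) => [|i _]; last exact: diag1.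
by rewrite sumr_const card_ord.
Qed.

(** A diagonal entry of [Gamma] is an average of the eigenvalues with weights [U i k ^+ 2], so the
    value 1 cannot exceed the largest eigenvalue. *)
Lemma unit_diag_top_ge1 : 1 <= lam 0 ord0.
Proof.
case: eig => UU GE sorted lam0; rewrite -(diag1 ord0) GE orth_diag_entry.
rewrite -[leRHS]mulr1 -(orth_row_sqr_sum ord0 UU) mulr_sumr.
by apply: ler_sum => k _; rewrite -expr2 ler_wpM2r ?sqr_ge0 ?sorted.
Qed.

Lemma unit_diag_top_le : lam 0 ord0 <= m.+1%:R.
Proof.
case: eig => _ _ _ lam0; rewrite -unit_diag_eigen_sum (bigD1 ord0)//= lerDl.
exact: sumr_ge0.
Qed.

(** This puts both methods into one form for the step estimates. The lower bound on [p] serves the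
    tangent part, [q] the normal part, and the weighted sum is the squared Frobenius norm of
    [P *m Psi]. NormPre-G takes [q = 1 / sigma_m], NormPre-L takes [q = 1]. *)
Lemma precond_spectral : is_precond M Gamma U lam P ->
  exists (p : 'rV[R]_m.+1) (q : R),
  [/\ P = U *m diag_mx p *m U^T,
      forall k, (Num.sqrt (lam 0 ord0))^-1 <= p 0 k <= q,
      \sum_k lam 0 k * p 0 k ^+ 2 <= m.+1%:R &
      chi M lam = q * Num.sqrt (lam 0 ord0)].
Proof.
have [UU GE sorted lam0] := eig.
have top1 := unit_diag_top_ge1.
case: M => [[Gpos [Gunit Ppos PP]]|r [C [CA _ _] ->]] /=.
- have lampos k : 0 < lam 0 k := posdef_eigen_gt0 k eig Gpos.
  have sqrtpos k : 0 < Num.sqrt (lam 0 k) by rewrite sqrtr_gt0.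
  pose p : 'rV[R]_m.+1 := \row_k (Num.sqrt (lam 0 k))^-1.
  have ple k :
      (Num.sqrt (lam 0 ord0))^-1 <= p 0 k <= (Num.sqrt (lam 0 ord_max))^-1.
    by rewrite mxE !lef_pV2 ?posrE// !ler_wsqrtr// sorted// leq_ord.
  exists p, (Num.sqrt (lam 0 ord_max))^-1; split=> //; last by rewrite mulrC.
    (* [is_inv_sqrt] gives [P] only as a positive definite root of the inverse of [Gamma];
       uniqueness of that root identifies it with the diagonal form. *)
    apply: posdef_sqrt_uniq => //.
      apply: (@posdef_orth_diag _ _ _ _ (Num.sqrt (lam 0 ord0))^-1) => //.
        by rewrite invr_gt0.
      by move=> k; case/andP: (ple k).
    rewrite PP orth_diag_mul//; apply: (can_inj (mulKmx Gunit)).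
    rewrite mulmxV// GE orth_diag_mul// -(mulmx1C UU); congr (_ *m _).
    rewrite -[LHS]mulmx1; congr (_ *m _); rewrite -diag_const_mx; congr diag_mx.
    apply/rowP => k; rewrite !mxE -invfM -expr2 sqr_sqrtr ?lam0//.
    by rewrite mulfV// gt_eqF.
  rewrite (eq_bigr (fun=> 1)) => [|k _]; first by rewrite sumr_const card_ord.
  by rewrite mxE exprVn sqr_sqrtr ?lam0// mulfV// gt_eqF.
- have s1 : 1 <= Num.sqrt (lam 0 ord0) by rewrite -[leLHS]sqrtr1 ler_wsqrtr.
  have s0 : 0 < Num.sqrt (lam 0 ord0) := lt_le_trans ltr01 s1.
  have act k : k \in C -> 1 < lam 0 k by move/(fintype.subsetP CA); rewrite inE.
  have cs1 k : k \in C -> 1 <= Num.sqrt (lam 0 k).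
    by move=> /act/ltW h; rewrite -[leLHS]sqrtr1 ler_wsqrtr.
  exists (\row_k if k \in C then (Num.sqrt (lam 0 k))^-1 else 1), 1.
  (* Unclipped directions have factor 1, which is at least [1 / sigma_1] because the top eigenvalue
     is at least 1. *)
  split; rewrite ?mul1r ?clip_precondE//.
    move=> k; rewrite mxE; case: ifP => [kC|_]; last first.
      by rewrite invf_le1// s1 lexx.
    have k0 : 0 < Num.sqrt (lam 0 k) := lt_le_trans ltr01 (cs1 k kC).
    by rewrite lef_pV2 ?posrE// ler_wsqrtr ?sorted// invf_le1// cs1.
  (* Compare with the trace: a clipped term is 1, below its eigenvalue, and any other term is its
     eigenvalue. *)
  rewrite -unit_diag_eigen_sum; apply: ler_sum => k _; rewrite mxE.
  case: ifP => [kC|_]; last by rewrite expr1n mulr1.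
  have k0 : 0 < lam 0 k := lt_trans ltr01 (act k kC).
  by rewrite exprVn sqr_sqrtr ?lam0// mulfV ?gt_eqF// ltW// act.
Qed.

End Preconditioner.

(** * Row norms and change of orientation *)

Lemma sum_sqr_le (R : realType) m (x : 'I_m -> R) : (forall i, 0 <= x i) ->
  \sum_i x i ^+ 2 <= (\sum_i x i) ^+ 2.
Proof.
move=> x0; rewrite expr2 mulr_suml; apply: ler_sum => i _.
by rewrite expr2 ler_wpM2l// (bigD1 i)//= lerDl sumr_ge0.
Qed.

(** Summing the row-wise alignment bounds produces the sum of row norms; this returns to [fnorm]
    without a dimension factor. *)
Lemma fnorm_le_sum_rows (R : realType) a b (A : 'M[R]_(a, b)) :
  fnorm A <= \sum_i fnorm (row i A).
Proof.
rewrite -ler_sqr ?nnegrE ?fnorm_ge0 ?sumr_ge0// => [|i _]; last first.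
  exact: fnorm_ge0.
apply: le_trans (sum_sqr_le _) => [|i]; last exact: fnorm_ge0.
by rewrite fnorm_sqr mxdot_row; under eq_bigr do rewrite -fnorm_sqr.
Qed.

Lemma mxdot_deorient (R : realType) k m n
    (A : 'M[R]_(wrows k m n, wcols k m n)) (B : 'M[R]_(m, n)) :
  mxdot A (deorient k B) = mxdot (orient A) B.
Proof. by case: k A => // A; rewrite -mxdot_tr trmxK. Qed.

Lemma deorientK (R : realType) k m n (B : 'M[R]_(m, n)) :
  orient (deorient k B) = B.
Proof. by case: k => //=; rewrite trmxK. Qed.

Lemma fnorm_orient (R : realType) k m n
    (A : 'M[R]_(wrows k m n, wcols k m n)) : fnorm (orient A) = fnorm A.
Proof. by case: k A => // A; rewrite /fnorm mxdot_tr. Qed.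

(** * Size and gradient alignment of one update *)

Section Step.
Variables (R : realType) (M : normpre) (m n : nat) (G W : 'M[R]_(m.+1, n)).
Variables (U P : 'M[R]_m.+1) (lam : 'rV[R]_m.+1) (gamma gamma' eps : R).
Let X := relaxed_tangent G W.
Let Psi := row_normalize X.
Let Gamma := Psi *m Psi^T.
Hypothesis row_neq0 : forall i, [/\ row i X != 0, row i G != 0 & row i W != 0].
Hypothesis eig : sorted_eigendecomp Gamma U lam.
Hypothesis precond : is_precond M Gamma U lam P.

Lemma row_relaxed_tangent i :
  row i X = row i G - mxdot (row i G) (row i W) *: row i W.
Proof. by rewrite rowK. Qed.

Lemma row_row_normalize i : row i Psi = (fnorm (row i X))^-1 *: row i X.
Proof. by rewrite rowK. Qed.

Lemma row_tangent_gt0 i : 0 < fnorm (row i X).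
Proof. by rewrite fnorm_gt0; case: (row_neq0 i). Qed.

Lemma row_tangentE i : row i X = fnorm (row i X) *: row i Psi.
Proof.
by rewrite row_row_normalize scalerA mulfV ?scale1r// gt_eqF// row_tangent_gt0.
Qed.

Lemma row_normalize_neq0 i : row i Psi != 0.
Proof.
rewrite row_row_normalize scaler_eq0 invr_eq0 negb_or.
rewrite gt_eqF ?row_tangent_gt0//=.
by case: (row_neq0 i).
Qed.

Lemma fnorm_row_normalize i : fnorm (row i Psi) = 1.
Proof.
rewrite row_row_normalize fnormZ ger0_norm ?invr_ge0 ?fnorm_ge0//.
by rewrite mulVf// gt_eqF// row_tangent_gt0.
Qed.

Lemma gram_diag1 i : Gamma i i = 1.
Proof. by rewrite -mxdot_rows -fnorm_sqr fnorm_row_normalize expr1n. Qed.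

Lemma precond_sqr_le : mxdot (P *m Psi) (P *m Psi) <= m.+1%:R.
Proof.
have [p [q [-> _ le_m _]]] := precond_spectral eig gram_diag1 precond.
have [UU GE _ _] := eig; apply: le_trans le_m.
rewrite /mxdot trmx_mul orth_diag_tr mulmxA -(mulmxA _ Psi) -/Gamma GE.
rewrite !orth_diag_mul// orth_diag_trace//; apply: ler_sum => k _.
by rewrite !mxE le_eqVlt; apply/orP; left; apply/eqP; ring.
Qed.

Hypothesis gamma_gt0 : 0 < gamma.
Hypothesis sin_ge : forall i, gamma <= sin (angle (row i G) (row i W)).
Hypothesis cos_le : forall i,
  Num.sqrt (\sum_j cos (angle (row j Psi) (row i W)) ^+ 2) <= gamma'.
Hypothesis eps_gt0 : 0 < eps.
Hypothesis cond_le : nu G X * gamma' * chi M lam <= 1 - eps.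

Lemma precond_row_align i :
  eps * gamma / Num.sqrt m.+1%:R * fnorm (row i G) <=
  mxdot (row i G) (row i (P *m Psi)).
Proof.
have [p [q [PE p_itv _ chiE]]] := precond_spectral eig gram_diag1 precond.
have [UU GE _ lam0] := eig.
set s := Num.sqrt (lam 0 ord0) in p_itv chiE.
have s0 : 0 < s.
  by rewrite sqrtr_gt0 (lt_le_trans ltr01)// (unit_diag_top_ge1 eig gram_diag1).
have s0' : 0 < s^-1 by rewrite invr_gt0.
have p0 k : 0 <= p 0 k by case/andP: (p_itv k) => /(le_trans (ltW s0')).
have q0 : 0 <= q by case/andP: (p_itv ord0) => _; apply: le_trans.
have [xi0 gi0 wi0] := row_neq0 i.
set x := fnorm (row i X); have x0 : 0 < x := row_tangent_gt0 i.
(* The entry [(Gamma P)_ii] is the sum of [lam_k p_k U_ik^2]; it is compared termwise with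
   [Gamma_ii / s]. *)
have tangent_part : x / s <= mxdot (row i X) (row i (P *m Psi)).
  rewrite row_tangentE mxdotZl ler_wpM2l ?fnorm_ge0//.
  rewrite mxdot_rows trmx_mul mulmxA -/Gamma PE orth_diag_tr.
  rewrite GE orth_diag_mul// orth_diag_entry -[leLHS]mulr1.
  rewrite -(gram_diag1 i) GE orth_diag_entry mulr_sumr.
  apply: ler_sum => k _; rewrite mxE [leLHS]mulrA -expr2 ler_wpM2r ?sqr_ge0//.
  by rewrite mulrC ler_wpM2l//; case/andP: (p_itv k).
(* The squared norm of row [i] of [P] is an average of the [p_k^2] with weights [U i k ^+ 2]. *)
have Prow : Num.sqrt (\sum_j P i j ^+ 2) <= q.
  rewrite -[leRHS]ger0_norm// -sqrtr_sqr ler_wsqrtr//.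
  have -> : \sum_j P i j ^+ 2 = (P *m P^T) i i.
    by rewrite mxE; apply: eq_bigr => j _; rewrite mxE expr2.
  rewrite PE orth_diag_tr orth_diag_mul// orth_diag_entry.
  rewrite -[leRHS]mulr1 -(orth_row_sqr_sum i UU) mulr_sumr.
  apply: ler_sum => k _; rewrite mxE -!expr2 ler_wpM2r ?sqr_ge0//.
  by rewrite ler_sqr ?nnegrE//; case/andP: (p_itv k).
(* Rows of [Psi] are unit vectors, so their products with [w_i] are [|w_i|] times cosines;
   Cauchy-Schwarz over [j] pairs these cosines with row [i] of [P]. *)
have weight_dot : `|mxdot (row i W) (row i (P *m Psi))| <=
                  fnorm (row i W) * (q * gamma').
  rewrite mxdotC mxdot_mulmx_row.
  under eq_bigr do rewrite mxdot_cos_angle ?row_normalize_neq0//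
    fnorm_row_normalize mul1r mulrCA.
  rewrite -mulr_sumr normrM ger0_norm ?fnorm_ge0// ler_wpM2l ?fnorm_ge0//.
  apply: le_trans (sum_mul_le _ _) _.
  by rewrite ler_pM ?sqrtr_ge0.
have g'0 : 0 <= gamma' by apply: le_trans (cos_le i); rewrite sqrtr_ge0.
have normal_part :
    `|mxdot (row i G - row i X) (row i (P *m Psi))| <=
    nu G X * x * (q * gamma').
  have nux : fnorm (row i G - row i X) <= nu G X * x.
    rewrite -ler_pdivrMr//.
    exact: (le_bigmax _ (fun i => fnorm (row i G - row i X) / fnorm (row i X))).
  apply: le_trans (ler_wpM2r (mulr_ge0 q0 g'0) nux).
  have -> : row i G - row i X = mxdot (row i G) (row i W) *: row i W.
    by rewrite row_relaxed_tangent opprB addrC subrK.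
  by rewrite mxdotZl fnormZ normrM -mulrA ler_wpM2l.
have x_ge : gamma * fnorm (row i G) <= x.
  rewrite /x row_relaxed_tangent; apply: le_trans (fnorm_sin_angle_le gi0 wi0).
  by rewrite mulrC ler_wpM2l ?fnorm_ge0.
have s_le : s <= Num.sqrt m.+1%:R.
  by rewrite ler_wsqrtr// (unit_diag_top_le eig gram_diag1).
have sm_inv : (Num.sqrt m.+1%:R)^-1 <= s^-1.
  by rewrite lef_pV2 ?posrE// (lt_le_trans s0).
have -> : mxdot (row i G) (row i (P *m Psi)) =
    mxdot (row i X) (row i (P *m Psi)) +
    mxdot (row i G - row i X) (row i (P *m Psi)).
  by rewrite -mxdotDl addrC subrK.
(* Since [chi = q * s], this is [cond_le] multiplied by [x / s]. *)
have chi_le : nu G X * x * (q * gamma') <= x / s * (1 - eps).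
  apply: le_trans (ler_wpM2l _ cond_le); last by rewrite divr_ge0 ?ltW.
  rewrite chiE le_eqVlt; apply/orP; left; apply/eqP; field.
  by rewrite gt_eqF.
apply: (@le_trans _ _ (x / s * eps)).
  have -> : eps * gamma / Num.sqrt m.+1%:R * fnorm (row i G) =
    (gamma * fnorm (row i G)) * (Num.sqrt m.+1%:R)^-1 * eps by ring.
  rewrite ler_pM2r// ler_pM// ?invr_ge0 ?sqrtr_ge0//.
  by rewrite mulr_ge0 ?fnorm_ge0 ?ltW.
by move: normal_part; rewrite ler_norml => /andP[? _]; lra.
Qed.

Lemma precond_align :
  eps * gamma / Num.sqrt m.+1%:R * fnorm G <= mxdot G (P *m Psi).
Proof.
apply: le_trans (ler_wpM2l _ (fnorm_le_sum_rows G)) _.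
  by rewrite divr_ge0 ?sqrtr_ge0// mulr_ge0 ?ltW.
by rewrite mulr_sumr mxdot_row ler_sum// => i _; exact: precond_row_align.
Qed.

End Step.

(** * Telescoping and the final rate *)

Lemma sum_decrease (R : realType) (F : nat -> R) (T : nat) (d : R) :
  (forall t, (t <= T)%N -> F t.+1 <= F t - d) ->
  F T.+1 <= F 0%N - T.+1%:R * d.
Proof.
elim: T => [|T IH] h; first by rewrite mul1r h.
have := IH (fun t tT => h t (leqW tT)); have := h _ (leqnn T.+1).
by rewrite -[T.+2]addn1 natrD; lra.
Qed.

Theorem theorem1 (R : realType) (k : bool) (m n : nat) (M : normpre)
  (f : 'M[R]_(wrows k m.+1 n.+1, wcols k m.+1 n.+1) -> R) (L Linf : R)
  (T : nat) (C gamma gamma' eps : R)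
  (W : nat -> 'M[R]_(wrows k m.+1 n.+1, wcols k m.+1 n.+1))
  (U P : nat -> 'M[R]_m.+1) (lam : nat -> 'rV[R]_m.+1) :
  let Wb t := orient (W t) in
  let Gb t := orient (grad f (W t)) in
  let X t := relaxed_tangent (Gb t) (Wb t) in
  let Psi t := row_normalize (X t) in
  let Gamma t := Psi t *m (Psi t)^T in
  let Delta0 := f (W 0%N) - Linf in
  let eta := C / Num.sqrt T.+1%:R in
  valid_normpre M ->
  (forall V, differentiable f V) ->
  lsmooth f L ->
  (forall V, Linf <= f V) ->
  (forall t i, (t <= T)%N ->
     [/\ row i (X t) != 0, row i (Gb t) != 0 & row i (Wb t) != 0]) ->
  (forall t, (t <= T)%N -> sorted_eigendecomp (Gamma t) (U t) (lam t)) ->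
  (forall t, (t <= T)%N -> is_precond M (Gamma t) (U t) (lam t) (P t)) ->
  (forall t, (t <= T)%N ->
     W t.+1 = W t - eta *: deorient k (P t *m Psi t)) ->
  0 < gamma ->
  (forall t i, (t <= T)%N ->
     gamma <= sin (angle (row i (Gb t)) (row i (Wb t)))) ->
  (forall t i, (t <= T)%N ->
     Num.sqrt (\sum_j cos (angle (row j (Psi t)) (row i (Wb t))) ^+ 2)
       <= gamma') ->
  0 < eps ->
  maxord (fun t : 'I_T.+1 => nu (Gb t) (X t) * gamma' * chi M (lam t))
    <= 1 - eps ->
  0 < C ->
  minord (fun t : 'I_T.+1 => fnorm (grad f (W t)))
    <= (Num.sqrt T.+1%:R)^-1
       * (Delta0 * (maxn m.+1 n.+1)%:R `^ (1 / 2) / (eps * gamma * C)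
          + L * C * (maxn m.+1 n.+1)%:R `^ (3 / 2) / (2 * eps * gamma)).
Proof.
move=> Wb Gb X Psi Gamma Delta0 eta Mv f_diff f_smooth f_ge neq0 eig precond
  update gamma0 sin_ge cos_le eps0 cond C0.
have L0 : 0 <= L.
  (* The dimensions reduce to successors only once the orientation is fixed. *)
  by clear -f_smooth; case: k f f_smooth => f' /lsmooth_ge0.
set mu := minord _; set N : R := (maxn m.+1 n.+1)%:R; set s := Num.sqrt _.
have mN : m.+1%:R <= N by rewrite ler_nat leq_maxl.
have N0 : 0 < N by apply: lt_le_trans mN; rewrite ltr0n.
have s0 : 0 < s by rewrite sqrtr_gt0 ltr0n.
have r0 : 0 < Num.sqrt N by rewrite sqrtr_gt0.
have eta0 : 0 < eta by rewrite divr_gt0.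
have mu_le t : (t <= T)%N -> mu <= fnorm (Gb t).
  move=> tT; rewrite fnorm_orient.
  exact: (bigmin_le _ (Ordinal (tT : (t < T.+1)%N))).
have mu0 : 0 <= mu.
  rewrite /mu /minord; elim/big_ind: _ => [|x y x0 y0|i _];
    by rewrite ?le_min ?x0 ?y0 ?fnorm_ge0.
(* A decrease valid at every step: [mu] replaces the gradient norm, and [N] replaces [m.+1] both
   under the root and as the bound on the squared update. *)
pose d := eta * (eps * gamma / Num.sqrt N * mu) - L / 2 * eta ^+ 2 * N.
have step t : (t <= T)%N -> f (W t.+1) <= f (W t) - d.
  move=> tT.
  have condt : nu (Gb t) (X t) * gamma' * chi M (lam t) <= 1 - eps.
    apply: le_trans cond.
    exact: (le_bigmax _
      (fun t : 'I_T.+1 => nu (Gb t) (X t) * gamma' * chi M (lam t))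
      (Ordinal (tT : (t < T.+1)%N))).
  have align := precond_align (neq0 t ^~ tT) (eig t tT) (precond t tT) gamma0
    (sin_ge t ^~ tT) (cos_le t ^~ tT) eps0 condt.
  have norm_le := precond_sqr_le (neq0 t ^~ tT) (eig t tT) (precond t tT).
  rewrite update//; apply: le_trans (descent f_diff f_smooth _ _) _.
  rewrite mxdotNr mxdotNl mxdotNr opprK !mxdotZr mxdotZl !mxdot_deorient.
  rewrite deorientK -/(Gb t) -/(Psi t).
  set g := mxdot _ _ in align *; set w := mxdot _ _ in norm_le *.
  have : eps * gamma / Num.sqrt N * mu <= g.
    apply: le_trans align; rewrite ler_pM ?mu_le//.
      by rewrite divr_ge0 ?ltW// mulr_gt0.
    rewrite ler_pM2l ?mulr_gt0// lef_pV2 ?posrE ?sqrtr_gt0 ?ltr0n ?leq_max//.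
    by rewrite ler_wsqrtr.
  move=> /(ler_wpM2l (ltW eta0)).
  have : L / 2 * eta ^+ 2 * w <= L / 2 * eta ^+ 2 * N.
    by rewrite ler_wpM2l ?(le_trans norm_le)// mulr_ge0 ?sqr_ge0// divr_ge0.
  rewrite /d; lra.
have := sum_decrease step; have := f_ge (W T.+1).
have -> : T.+1%:R = s ^+ 2 by rewrite sqr_sqrtr.
(* As [eta = C / s], the linear gain grows like [s] over the [T.+1] steps while the quadratic loss
   stays constant. *)
have -> : s ^+ 2 * d =
    s * C * eps * gamma * mu / Num.sqrt N - L * C ^+ 2 * N / 2.
  by rewrite /d /eta -/s; field; rewrite !gt_eqF.
move=> fT fsum.
have key : s * C * eps * gamma * mu / Num.sqrt N <= Delta0 + L * C ^+ 2 * N / 2.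
  by rewrite /Delta0; lra.
have -> : N `^ (1 / 2) = Num.sqrt N by rewrite div1r powR12_sqrt ?ltW.
have -> : N `^ (3 / 2) = N * Num.sqrt N.
  have -> : (3 / 2 : R) = 1 + 2^-1 by field.
  by rewrite powRD ?powRr1 ?powR12_sqrt ?ltW// gt_eqF ?implybT.
rewrite mulrC ler_pdivlMr//.
(* Multiplying [key] by this factor isolates [mu * s]; the extra [Num.sqrt N] yields the exponents
   1/2 and 3/2. *)
have -> : mu * s = s * C * eps * gamma * mu / Num.sqrt N *
    (Num.sqrt N / (eps * gamma * C)) by field; rewrite !gt_eqF.
apply: le_trans (ler_wpM2r _ key) _.
  by rewrite divr_ge0 ?ltW// !mulr_gt0.
rewrite le_eqVlt; apply/orP; left; apply/eqP; field.
by rewrite !gt_eqF.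
Qed.
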